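(* Let $\Phi$ be an $N$-function whose Matuszewska-Orlicz indices satisfy $1<\alpha_\Phi\le\beta_\Phi<\infty$, and let $0<\theta<2\min\{1/\beta_\Phi,1-1/\alpha_\Phi\}$. Let $\Phi_\theta(t):=\widetilde{\Psi}_\theta^{-1}(t)$ for $t\ge0$, where $\widetilde\Psi_\theta$ is the least concave majorant of the function $\Psi_\theta$ given by $\Psi_\theta(0):=0$ and $\Psi_\theta(t):=\left(\Phi^{-1}(t)\,t^{-\theta/2}\right)^{1/(1-\theta)}$ for $t>0$. Then $\Phi_\theta$ is an $N$-function whose Matuszewska-Orlicz indices satisfy $$1<\alpha_{\Phi_\theta}\le\beta_{\Phi_\theta}<\infty.$$
   Context: An $N$-function is a continuous, increasing, convex function $\Phi:[0,\infty)\to[0,\infty)$ with $\Phi(t)=0$ iff $t=0$, $\lim_{t\to0^+}\Phi(t)/t=0$ and $\lim_{t\to\infty}\Phi(t)/t=\infty$. For $t>0$ let $M(t,\Phi):=\sup_{0<u<\infty}\Phi(tu)/\Phi(u)\in(0,\infty]$. The Matuszewska-Orlicz indices are $\alpha_\Phi:=\sup_{0<t<1}\frac{\ln M(t,\Phi)}{\ln t}$ and $\beta_\Phi:=\inf_{t>1}\frac{\ln M(t,\Phi)}{\ln t}$. For $\Psi:[0,\infty)\to[0,\infty)$ with $\Psi(t)=0$ iff $t=0$, its least concave majorant $\widetilde\Psi$ is the pointwise infimum of all functions $F:[0,\infty)\to[0,\infty)$ that are concave on $[0,\infty)$, satisfy $F(t)=0$ iff $t=0$, and satisfy $\Psi(t)\le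 F(t)$ for all $t\ge0$. The notation $\Phi^{-1}$, $\widetilde\Psi_\theta^{-1}$ means inverse functions on $[0,\infty)$. The condition on $\theta$ forces $\theta<1$. *)

(* Defs.v *)
From HB Require Import structures.
From mathcomp Require Import all_boot all_order all_algebra.
From mathcomp Require Import all_classical all_reals all_analysis.
Set Implicit Arguments.
Unset Strict Implicit.
Unset Printing Implicit Defensive.
Import Order.TTheory GRing.Theory Num.Theory.
Import numFieldNormedType.Exports.

Local Open Scope classical_set_scope.
Local Open Scope ring_scope.

(* A function from [0, oo) to [0, oo) is represented by a function R -> R;
   every notion below depends only on its values on [0, oo). *)

Definition concave_on (R : realType) (D : set R) (F : R -> R) : Prop :=
  convex_function D (fun t => - F t).

(* "Increasing" is read strictly; under the other clauses the weak and the
   strict readings are equivalent. *)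
Record N_function (R : realType) (Phi : R -> R) : Prop := {
  N_ge0 : {in `[0, +oo[, forall t, 0 <= Phi t} ;
  N_continuous : {within `[0, +oo[, continuous Phi} ;
  N_increasing : {in `[0, +oo[ &, {homo Phi : x y / x < y}} ;
  N_convex : convex_function (`[0, +oo[%classic : set R) Phi ;
  N_eq0 : {in `[0, +oo[, forall t, Phi t = 0 <-> t = 0} ;
  N_cvg0 : Phi t / t @[t --> 0^'+] --> (0 : R) ;
  N_cvgy : Phi t / t @[t --> +oo] --> +oo }.

Section indices.
Context (R : realType).
Implicit Types (Phi : R -> R) (t : R).
Local Open Scope ereal_scope.

Definition dilation_sup t Phi : \bar R :=
  ereal_sup [set (Phi (t * u) / Phi u)%:E | u in `]0%R, +oo[].

(* The quotients are taken in \bar R, where lne +oo = +oo. *)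
Definition index_alpha Phi : \bar R :=
  ereal_sup [set lne (dilation_sup t Phi) / (ln t)%:E | t in `]0%R, 1%R[].

Definition index_beta Phi : \bar R :=
  ereal_inf [set lne (dilation_sup t Phi) / (ln t)%:E | t in `]1%R, +oo[].

End indices.

(* pinv_ chooses a preimage in [0, oo); it is the inverse function as soon as
   f is a bijection of [0, oo) onto itself. *)
Definition inverse_ge0 (R : realType) (f : R -> R) : R -> R :=
  'pinv_(fun=> 0) `[0, +oo[ f.

Record concave_majorant (R : realType) (Psi F : R -> R) : Prop := {
  majorant_ge0 : {in `[0, +oo[, forall t, 0 <= F t} ;
  majorant_concave : concave_on `[0, +oo[ F ;
  majorant_eq0 : {in `[0, +oo[, forall t, F t = 0 <-> t = 0} ;
  majorant_le : {in `[0, +oo[, forall t, Psi t <= F t} }.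

Definition least_concave_majorant (R : realType) (Psi : R -> R) (t : R) : R :=
  inf [set F t | F in concave_majorant Psi].

Definition Psi_theta (R : realType) (Phi : R -> R) (theta t : R) : R :=
  if t == 0 then 0
  else (inverse_ge0 Phi t * t `^ (- theta / 2)) `^ (1 / (1 - theta)).

Definition Phi_theta (R : realType) (Phi : R -> R) (theta : R) : R -> R :=
  inverse_ge0 (least_concave_majorant (Psi_theta Phi theta)).

(* Main.v *)
(* Say that f has growth (p, q) if t^p f(u) / C <= f(t u) <= C t^q f(u) for all
   t >= 1 and u > 0. Reading the indices of Phi at one suitable t < 1 and one
   suitable t > 1 and iterating gives Phi growth (p, q) with theta/2 < 1 - 1/p
   and theta/2 < 1/q, so Psi_theta has growth (b, a) with 0 < b <= a < 1. For
   each s > 0 the function u |-> C Psi(s) ((u/s)^a + (u/s)^b) is then a concave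
   majorant of Psi whose value at s is 2 C Psi(s); hence the least concave
   majorant is comparable to Psi and inherits its growth, and its inverse has
   growth (1/a, 1/b) with 1/a > 1, which yields all the claims. *)
Require Import Defs.
From HB Require Import structures.
From mathcomp Require Import all_boot all_order all_algebra.
From mathcomp Require Import all_classical all_reals all_analysis.
From mathcomp Require Import ring lra.
Import Order.TTheory GRing.Theory Num.Theory.
Import numFieldNormedType.Exports.
Local Open Scope classical_set_scope.
Local Open Scope ring_scope.

(** * Increasing bijections of the half-line and their inverses *)

Section increasing_bijections.
Context {R : realType}.
Implicit Types (f : R -> R) (x y t : R).

Record increasing_bij f : Prop := {
  ibij_lt : forall x y, 0 <= x -> x < y -> f x < f y ;
  ibij_bij : set_bij `[0, +oo[ `[0, +oo[ f }.

Lemma increasing_bij_intro f :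
  (forall x y, 0 <= x -> x < y -> f x < f y) -> f 0 = 0 ->
  (forall y, 0 < y -> exists2 x, 0 <= x & f x = y) -> increasing_bij f.
Proof.
move=> f_lt f0 f_surj; split=> //; split.
- move=> x /=; rewrite !in_itv/= !andbT le_eqVlt => /orP[/eqP <-|x0].
    by rewrite f0.
  by rewrite -f0 ltW// f_lt.
- move=> x y; rewrite !inE/= !in_itv/= !andbT => x0 y0 fxy.
  have [xy|yx|//] := ltgtP x y.
    by have := f_lt _ _ x0 xy; rewrite fxy ltxx.
  by have := f_lt _ _ y0 yx; rewrite fxy ltxx.
- move=> y /=; rewrite !in_itv/= !andbT le_eqVlt => /orP[/eqP <-|y0].
    by exists 0 => //=; rewrite in_itv/= lexx.
  by have [x x0 fx] := f_surj _ y0; exists x => //=; rewrite in_itv/= x0.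
Qed.

Lemma ibij_le f x y : increasing_bij f -> 0 <= x -> x <= y -> f x <= f y.
Proof.
move=> [f_lt _] x0; rewrite le_eqVlt => /orP[/eqP ->//|xy].
exact/ltW/f_lt.
Qed.

Lemma ibij_leE f x y :
  increasing_bij f -> 0 <= x -> 0 <= y -> (f x <= f y) = (x <= y).
Proof.
move=> fb x0 y0; have [/(ibij_le _ _ _ fb)->//|yx] := leP x y.
by apply/negbTE; rewrite -ltNge ibij_lt.
Qed.

Lemma ibij_ge0 f x : increasing_bij f -> 0 <= x -> 0 <= f x.
Proof.
by move=> [_ [+ _ _]] x0 => /(_ x); rewrite /= !in_itv/= !andbT; exact.
Qed.

Lemma ibij0 f : increasing_bij f -> f 0 = 0.
Proof.
move=> fb; have [_ _ /(_ 0)] := ibij_bij _ fb.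
case; first by rewrite /= in_itv/= lexx.
move=> x /=; rewrite in_itv/= andbT le_eqVlt => /orP[/eqP <-//|x0 fx0].
by have := ibij_lt _ fb _ _ (lexx _) x0; rewrite fx0 ltNge ibij_ge0.
Qed.

Lemma ibij_gt0 f x : increasing_bij f -> 0 < x -> 0 < f x.
Proof. by move=> fb x0; rewrite -(ibij0 _ fb) ibij_lt. Qed.

Lemma inverse_ge0_ge0 f t : increasing_bij f -> 0 <= t -> 0 <= inverse_ge0 f t.
Proof.
move=> fb t0; have [+ _ _] := bijpinv_bij (fun=> 0) (ibij_bij _ fb).
by move=> /(_ t); rewrite /= !in_itv/= !andbT; exact.
Qed.

Lemma inverse_ge0K f t : increasing_bij f -> 0 <= t -> f (inverse_ge0 f t) = t.
Proof.
move=> fb t0; have [_ _ f_surj] := ibij_bij _ fb.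
by apply: (surjpK _ f_surj); rewrite inE/= in_itv/= t0.
Qed.

Lemma increasing_bij_inverse f :
  increasing_bij f -> increasing_bij (inverse_ge0 f).
Proof.
move=> fb; split; last exact/bijpinv_bij/ibij_bij.
move=> x y x0 xy; have y0 : 0 <= y by rewrite (le_trans x0)// ltW.
rewrite ltNge -(ibij_leE f) ?inverse_ge0_ge0//.
by rewrite !inverse_ge0K// -ltNge.
Qed.

(** A monotone map that omits no intermediate value cannot jump. This is used on segments starting
    at 0, which cover the half-line. *)
Lemma ibij_continuous f : increasing_bij f -> {within `[0, +oo[, continuous f}.
Proof.
move=> fb.
have f_seg b : 0 <= b -> {within `[0, b], continuous f}.
  move=> b0; apply: segment_inc_surj_continuous.
    move=> x y; rewrite !in_itv/= => /andP[x0 _] /andP[y0 _].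
    exact: ibij_leE.
  move=> y; rewrite /= in_itv/= (ibij0 _ fb) => /andP[y0 yb].
  exists (inverse_ge0 f y); last exact: inverse_ge0K.
  by rewrite /= in_itv/= inverse_ge0_ge0//= -(ibij_leE f) ?inverse_ge0_ge0//
    inverse_ge0K.
apply/continuous_within_itvcyP; split.
  move=> x; rewrite in_itv/= andbT => x0.
  have x1 : 0 < x + 1 by rewrite addr_gt0.
  have /(continuous_within_itvP _ x1)[+ _ _] := f_seg _ (ltW x1).
  by apply; rewrite in_itv/= x0 ltrDl ltr01.
by have /(continuous_within_itvP _ ltr01)[] := f_seg _ (@ler01 R).
Qed.

(** Surjectivity is the intermediate value theorem on a segment whose right end has a value of at
    least [y]; superlinear growth supplies that end. *)
Lemma N_function_increasing_bij f : N_function f -> increasing_bij f.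
Proof.
move=> fN; have f_lt x y : 0 <= x -> x < y -> f x < f y.
  move=> x0 xy; apply: (N_increasing fN); rewrite ?in_itv/= ?x0//.
  by rewrite (le_trans x0 (ltW xy)).
have f0 : f 0 = 0 by apply/(N_eq0 fN); rewrite ?in_itv/= ?lexx.
apply: increasing_bij_intro => // y y0.
have /cvgryPge/(_ y)[M [_ yM]] := N_cvgy fN.
(* [b] exceeds [M], so [y <= f b / b], and [b >= 1] turns this into [y <= f b]. *)
pose b := Num.max (M + 1) 1.
have b1 : 1 <= b by rewrite le_max lexx orbT.
have b0 : 0 < b by apply: lt_le_trans b1.
have yfb : y <= f b.
  have : y <= f b / b by apply: yM; rewrite lt_max ltrDl ltr01.
  by rewrite ler_pdivlMr//; apply: le_trans; rewrite ler_peMr// ltW.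
have f_cont : {within `[0, b], continuous f}.
  apply: continuous_subspaceW (N_continuous fN).
  by move=> x; rewrite /= !in_itv/= => /andP[->].
have [] := @IVT _ f 0 b y (ltW b0) f_cont.
  by rewrite f0 ge_min (ltW y0) le_max yfb orbT.
by move=> x; rewrite in_itv/= => /andP[x0 _] fx; exists x.
Qed.

End increasing_bijections.

(** * Power growth: iteration of dilations, inverses, passage to [Psi_theta] *)

Section power_growth.
Context {R : realType}.
Implicit Types (f : R -> R) (p q t u C : R).

Definition power_growth p q f : Prop :=
  exists2 C, 1 <= C & forall t u, 1 <= t -> 0 < u ->
    C^-1 * t `^ p * f u <= f (t * u) <= C * t `^ q * f u.

(** As both constants are at least 1, their product serves in both bounds. *)
Lemma power_growth_intro p q f C C' : 1 <= C -> 1 <= C' ->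
  (forall u, 0 < u -> 0 <= f u) ->
  (forall t u, 1 <= t -> 0 < u -> C^-1 * t `^ p * f u <= f (t * u)) ->
  (forall t u, 1 <= t -> 0 < u -> f (t * u) <= C' * t `^ q * f u) ->
  power_growth p q f.
Proof.
move=> C1 C'1 f0 f_lo f_up.
have C0 : 0 < C by apply: lt_le_trans C1.
have C'0 : 0 < C' by apply: lt_le_trans C'1.
exists (C * C'); first by rewrite -[leLHS]mul1r ler_pM.
move=> t u t1 u0; apply/andP; split.
  apply: le_trans (f_lo _ _ t1 u0); rewrite -!mulrA ler_wpM2r//.
    by rewrite mulr_ge0 ?powR_ge0 ?f0.
  by rewrite lef_pV2 ?posrE ?mulr_gt0// ler_peMr// ltW.
apply: le_trans (f_up _ _ t1 u0) _; rewrite -mulrA -[leRHS]mulrA -mulrA.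
by rewrite ler_peMl// !mulr_ge0 ?powR_ge0 ?f0// ltW.
Qed.

Lemma powRV (x r : R) : 0 <= x -> x^-1 `^ r = (x `^ r)^-1.
Proof. by move=> x0; rewrite -(powR_inv1 x0) -powRrM mulN1r powRN. Qed.

(** This is the lower growth bound at the factor [v / u], solved for [f u]: it controls [f] to the
    left of a point, as the upper bound does to the right. *)
Lemma power_growth_le p q f C u v : 0 < C ->
  (forall t u, 1 <= t -> 0 < u ->
    C^-1 * t `^ p * f u <= f (t * u) <= C * t `^ q * f u) ->
  0 < u -> u <= v -> f u <= C * (u / v) `^ p * f v.
Proof.
move=> C0 fC u0 uv; have v0 : 0 < v by apply: lt_le_trans uv.
have vu1 : 1 <= v / u by rewrite ler_pdivlMr ?mul1r.
have /andP[+ _] := fC _ _ vu1 u0; rewrite divfK ?gt_eqF// => lo.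
have vu0 : 0 < (v / u) `^ p by rewrite powR_gt0 ?divr_gt0.
have -> : (u / v) `^ p = ((v / u) `^ p)^-1.
  by rewrite -powRV ?invf_div// divr_ge0 ?ltW.
have -> : f u = C * ((v / u) `^ p)^-1 * (C^-1 * (v / u) `^ p * f u).
  by field; rewrite !gt_eqF.
by rewrite ler_wpM2l// mulr_ge0 ?invr_ge0 ?ltW.
Qed.

Lemma powRVK (r x : R) : 0 < r -> 0 <= x -> (x `^ r^-1) `^ r = x.
Proof. by move=> r0 x0; rewrite -powRrM mulVf ?gt_eqF// powRr1. Qed.

Lemma powR_ge1 (x r : R) : 1 <= x -> 0 <= r -> 1 <= x `^ r.
Proof. by move=> x1 r0; rewrite -[leLHS](powRr0 x) ler_powR. Qed.

(** The growth of [f] is applied at [inverse_ge0 f u], with factor [(t / C) ^ (1/q)] for the lower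
    bound and [(C t) ^ (1/p)] for the upper one, so that the constant cancels. Upper growth of [f]
    thus gives lower growth of the inverse, and conversely. *)
Lemma power_growth_inverse p q f : increasing_bij f -> 0 < p -> p <= q ->
  power_growth p q f -> power_growth q^-1 p^-1 (inverse_ge0 f).
Proof.
move=> fb p0 pq [C C1 fC].
have q0 : 0 < q by apply: lt_le_trans pq.
have C0 : 0 < C by apply: lt_le_trans C1.
have K1 r : 0 < r -> 1 <= C `^ r^-1.
  by move=> r0; rewrite powR_ge1// invr_ge0 ltW.
have gb := increasing_bij_inverse _ fb.
have g0 u : 0 < u -> 0 < inverse_ge0 f u by exact: ibij_gt0.
apply: (@power_growth_intro _ _ _ (C `^ q^-1) (C `^ p^-1)); rewrite ?K1//.
- by move=> u /g0/ltW.
- move=> t u t1 u0.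
  have t0 : 0 < t by apply: lt_le_trans t1.
  have tu0 : 0 <= t * u by rewrite mulr_ge0 ?ltW.
  have -> : (C `^ q^-1)^-1 * t `^ q^-1 = (t / C) `^ q^-1.
    by rewrite powRM ?invr_ge0 ?ltW// powRV ?ltW// mulrC.
  have [Ct|tC] := leP C t.
    have tC1 : 1 <= (t / C) `^ q^-1.
      by rewrite powR_ge1 ?invr_ge0 ?(ltW q0)// ler_pdivlMr ?mul1r.
    rewrite -(ibij_leE f) ?mulr_ge0 ?inverse_ge0_ge0 ?powR_ge0 ?(ltW u0)//.
    have /andP[_] := fC _ _ tC1 (g0 _ u0).
    rewrite !inverse_ge0K ?(ltW u0)// powRVK ?divr_ge0 ?(ltW t0) ?(ltW C0)//.
    by rewrite [C * _]mulrC divfK ?gt_eqF.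
  (* For [t < C] the factor is below 1 and growth does not apply, but then monotonicity of the
     inverse is enough. *)
  apply: le_trans (ibij_le _ u (t * u) gb (ltW u0) _); last first.
    by rewrite ler_peMl// ltW.
  rewrite ler_piMl// ?(ltW (g0 _ u0))//.
  rewrite -[leRHS](_ : 1 `^ q^-1 = 1); last by rewrite powR1.
  rewrite ge0_ler_powR ?invr_ge0 ?nnegrE ?divr_ge0 ?(ltW q0) ?(ltW t0) ?(ltW C0)//.
 
  by rewrite ler_pdivrMr// mul1r ltW.
- move=> t u t1 u0.
  have t0 : 0 < t by apply: lt_le_trans t1.
  have tu0 : 0 <= t * u by rewrite mulr_ge0 ?ltW.
  have Ct1 : 1 <= C * t by rewrite -[leLHS]mul1r ler_pM.
  rewrite -powRM ?(ltW t0) ?(ltW C0)//.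
  rewrite -(ibij_leE f) ?mulr_ge0 ?inverse_ge0_ge0 ?powR_ge0 ?(ltW u0)//.
  have Ctp : 1 <= (C * t) `^ p^-1 by rewrite powR_ge1// invr_ge0 ltW.
  have /andP[+ _] := fC _ _ Ctp (g0 _ u0).
  rewrite !inverse_ge0K ?(ltW u0)// powRVK ?mulr_ge0 ?(ltW t0) ?(ltW C0)//.
  by rewrite mulKf ?gt_eqF.
Qed.

Lemma exprn_sandwich (r x : R) : 1 < r -> 1 <= x ->
  exists n, r ^+ n <= x <= r ^+ n.+1.
Proof.
move=> r1 x1; have r0 : 0 < r by apply: lt_trans r1.
have x0 : 0 < x by apply: lt_le_trans x1.
have lr0 : 0 < ln r by rewrite ln_gt0.
have y0 : 0 <= ln x / ln r by apply: divr_ge0; [exact: ln_ge0|exact: ltW].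
have -> : x = r `^ (ln x / ln r).
  by apply: ln_inj; rewrite ?posrE ?powR_gt0// ln_powR divfK ?gt_eqF.
exists (Num.truncn (ln x / ln r)).
have /andP[lo up] := truncn_itv y0.
by rewrite -!powR_mulrn ?(ltW r0)// !ler_powR ?(ltW r1) ?(ltW up).
Qed.

(** Iteration gives the bounds at the powers of [r] and [s]. A general [t] lies between consecutive
    powers, and monotonicity costs one factor [r ^ p] or [s ^ q]; these are the constants. *)
Lemma power_growth_dilation p q (r s : R) f : 0 <= p -> 0 <= q -> 1 < r -> 1 < s ->
  (forall u, 0 < u -> 0 <= f u) ->
  (forall u v, 0 < u -> u <= v -> f u <= f v) ->
  (forall u, 0 < u -> r `^ p * f u <= f (r * u)) ->
  (forall u, 0 < u -> f (s * u) <= s `^ q * f u) ->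
  power_growth p q f.
Proof.
move=> p0 q0 r1 s1 f0 f_le f_lo f_up.
have r0 : 0 < r by apply: lt_trans r1.
have s0 : 0 < s by apply: lt_trans s1.
have f_lon n u : 0 < u -> (r ^+ n) `^ p * f u <= f (r ^+ n * u).
  move=> u0; elim: n => [|n ih]; first by rewrite expr0 powR1 !mul1r.
  rewrite exprS powRM ?exprn_ge0 ?(ltW r0)// -!mulrA.
  apply: le_trans (f_lo _ _); last by rewrite mulr_gt0 ?exprn_gt0.
  by rewrite ler_wpM2l ?powR_ge0.
have f_upn n u : 0 < u -> f (s ^+ n * u) <= (s ^+ n) `^ q * f u.
  move=> u0; elim: n => [|n ih]; first by rewrite expr0 powR1 !mul1r.
  rewrite exprS powRM ?exprn_ge0 ?(ltW s0)// -!mulrA.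
  apply: le_trans (f_up _ _) _; first by rewrite mulr_gt0 ?exprn_gt0.
  by rewrite ler_wpM2l ?powR_ge0.
apply: (@power_growth_intro _ _ _ (r `^ p) (s `^ q)) => //.
- by rewrite powR_ge1// ltW.
- by rewrite powR_ge1// ltW.
- move=> t u t1 u0; have [n /andP[nt tn]] := exprn_sandwich _ _ r1 t1.
  have t0 : 0 < t by apply: lt_le_trans t1.
  have rn0 : 0 < r ^+ n by rewrite exprn_gt0.
  apply: le_trans (f_le (r ^+ n * u) _ _ _); last 2 first.
  - by rewrite mulr_gt0.
  - by rewrite ler_wpM2r// ltW.
  apply: le_trans (f_lon _ _ u0); rewrite ler_wpM2r ?f0//.
  rewrite ler_pdivrMl ?powR_gt0// -powRM ?(ltW r0) ?(ltW rn0)// -exprS.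
  by rewrite ge0_ler_powR ?nnegrE ?exprn_ge0 ?(ltW t0) ?(ltW r0).
- move=> t u t1 u0; have [n /andP[nt tn]] := exprn_sandwich _ _ s1 t1.
  have t0 : 0 < t by apply: lt_le_trans t1.
  have sn0 : 0 < s ^+ n by rewrite exprn_gt0.
  apply: le_trans (f_le _ (s ^+ n.+1 * u) _ _) _.
  - by rewrite mulr_gt0.
  - by rewrite ler_wpM2r// ltW.
  apply: le_trans (f_upn _ _ u0) _; rewrite ler_wpM2r ?f0//.
  rewrite exprS powRM ?(ltW s0) ?(ltW sn0)// ler_wpM2l ?powR_ge0//.
  by rewrite ge0_ler_powR ?nnegrE ?(ltW t0) ?(ltW sn0).
Qed.

Lemma Psi_theta_gt0 f theta t :
  increasing_bij f -> 0 < t -> 0 < Psi_theta f theta t.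
Proof.
move=> fb t0; rewrite /Psi_theta gt_eqF// powR_gt0// mulr_gt0 ?powR_gt0//.
exact/ibij_gt0/t0/increasing_bij_inverse.
Qed.

(** The factor [t ^ (-theta/2)] lowers both exponents by [theta/2]; the outer power divides them by
    [1 - theta] and keeps the inequalities because [theta < 1]. *)
Lemma power_growth_Psi_theta p q f theta : increasing_bij f -> theta < 1 ->
  power_growth p q (inverse_ge0 f) ->
  power_growth ((p - theta / 2) / (1 - theta)) ((q - theta / 2) / (1 - theta))
    (Psi_theta f theta).
Proof.
move=> fb theta1 [C C1 gC].
have C0 : 0 < C by apply: lt_le_trans C1.
set k := 1 / (1 - theta).
have k0 : 0 <= k by rewrite divr_ge0// subr_ge0 ltW.
exists (C `^ k); first exact: powR_ge1.
move=> t u t1 u0; have t0 : 0 < t by apply: lt_le_trans t1.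
have tu0 : 0 < t * u by rewrite mulr_gt0.
have g_ge0 x : 0 < x -> 0 <= inverse_ge0 f x.
  by move=> x0; rewrite inverse_ge0_ge0 ?ltW.
have C'0 : 0 <= C^-1 by rewrite invr_ge0 ltW.
have CX (c y x : R) : 0 <= c -> 0 <= c * y `^ x.
  by move=> c0; rewrite mulr_ge0 ?powR_ge0.
have gu0 : 0 <= inverse_ge0 f u * u `^ (- theta / 2).
  by rewrite mulr_ge0 ?powR_ge0 ?g_ge0.
(* Used with [C^-1] and [p] for the lower bound, [C] and [q] for the upper one. *)
have distr (c x : R) : 0 <= c -> c `^ k * t `^ ((x - theta / 2) / (1 - theta)) *
      (inverse_ge0 f u * u `^ (- theta / 2)) `^ k =
    (c * t `^ x * inverse_ge0 f u * (t * u) `^ (- theta / 2)) `^ k.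
  move=> c0; have -> : c * t `^ x * inverse_ge0 f u * (t * u) `^ (- theta / 2) =
      c * t `^ (x - theta / 2) * (inverse_ge0 f u * u `^ (- theta / 2)).
    rewrite powRM ?(ltW t0) ?(ltW u0)// powRD; last by rewrite (gt_eqF t0) implybT.
    by rewrite mulNr; ring.
  rewrite [RHS](powRM _ (CX _ _ _ c0) gu0) (powRM _ c0 (powR_ge0 _ _)).
  rewrite -[(t `^ _) `^ _]powRrM.
  by rewrite /k mulrA mulr1.
have mono (v w : R) : 0 <= v -> v <= w ->
    (v * (t * u) `^ (- theta / 2)) `^ k <= (w * (t * u) `^ (- theta / 2)) `^ k.
  move=> v0 vw; have w0 := le_trans v0 vw.
  apply: ge0_ler_powR => //; rewrite ?nnegrE; [exact: CX|exact: CX|].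
  exact/ler_wpM2r/vw/powR_ge0.
have /andP[lo up] := gC _ _ t1 u0.
rewrite /Psi_theta !gt_eqF// -powRV ?(ltW C0)// (distr _ p C'0).
rewrite (distr _ q (ltW C0)).
apply/andP; split; apply: mono => //; last exact/g_ge0.
by apply: mulr_ge0; [exact: CX|exact: g_ge0].
Qed.

End power_growth.

(** * Concave functions on the half-line *)

Section concave_functions.
Context {R : realType}.
Implicit Types (F : R -> R) (a b l x y : R).

Lemma convex_function_ge0P F : convex_function (`[0, +oo[%classic : set R) F <->
  forall l x y, 0 <= l <= 1 -> 0 <= x -> 0 <= y ->
    F (l * x + (1 - l) * y) <= l * F x + (1 - l) * F y.
Proof.
split=> [cF l x y l01 x0 y0|cF l x y].
  have [l0 l1] := andP l01.
  by have := cF (Itv01 l0 l1) x y; rewrite !inE/= !in_itv/= x0 y0; apply.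
rewrite !inE/= !in_itv/= !andbT => x0 y0.
by apply: cF => //; rewrite ge0 le1.
Qed.

Lemma concave_on_ge0P F : concave_on `[0, +oo[ F <->
  forall l x y, 0 <= l <= 1 -> 0 <= x -> 0 <= y ->
    l * F x + (1 - l) * F y <= F (l * x + (1 - l) * y).
Proof.
rewrite /concave_on convex_function_ge0P; split=> cF l x y l01 x0 y0.
  by have := cF l x y l01 x0 y0; rewrite !mulrN -opprD lerN2.
by rewrite !mulrN -opprD lerN2 cF.
Qed.

(** Convexity of the power [1/a] is applied to [x ^ a] and [y ^ a], and the result is raised to the
    power [a]. *)
Lemma concave_powR a : 0 < a -> a <= 1 -> concave_on `[0, +oo[ (@powR R ^~ a).
Proof.
move=> a0 a1; apply/concave_on_ge0P => l x y /andP[l0 l1] x0 y0.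
have a1' : 1 <= a^-1 by rewrite invf_ge1.
have := convex_powR a1'; rewrite convex_function_ge0P => /(_ l (x `^ a) (y `^ a)).
rewrite l0 l1 => /(_ isT (powR_ge0 _ _) (powR_ge0 _ _)).
rewrite -!powRrM mulfV ?gt_eqF// !powRr1// => H.
have l1' : 0 <= 1 - l by rewrite subr_ge0.
have S0 : 0 <= l * x `^ a + (1 - l) * y `^ a.
  by rewrite addr_ge0 ?mulr_ge0 ?powR_ge0.
have s0 : 0 <= l * x + (1 - l) * y by rewrite addr_ge0 ?mulr_ge0.
rewrite -[leLHS](@powRVK _ a)//.
by apply: ge0_ler_powR => //; rewrite ?nnegrE ?powR_ge0// ltW.
Qed.

(** [x] is the convex combination of [l * x] and 0 with weights [1/l] and [1 - 1/l]. *)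
Lemma concave_scale_le F l x : concave_on `[0, +oo[ F -> 0 <= F 0 ->
  1 <= l -> 0 <= x -> F (l * x) <= l * F x.
Proof.
move=> /concave_on_ge0P cF F0 l1 x0; have l0 : 0 < l by apply: lt_le_trans l1.
have lV : 0 <= l^-1 <= 1 by rewrite invr_ge0 (ltW l0) invf_le1.
have := cF l^-1 (l * x) 0 lV (mulr_ge0 (ltW l0) x0) (lexx _).
rewrite mulr0 addr0 mulKf ?gt_eqF// => H.
rewrite -ler_pdivrMl//; apply: le_trans H.
by rewrite lerDl mulr_ge0// subr_ge0; case/andP: lV.
Qed.

Lemma powR_unbounded b K m : 0 < b -> exists2 t, m < t & 1 <= t /\ K < t `^ b.
Proof.
move=> b0; pose M := Num.max 0 K; have M0 : 0 <= M by rewrite le_max lexx.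
pose t := Num.max (m + 1) (1 + (M + 1) `^ b^-1).
have t1 : 1 + (M + 1) `^ b^-1 <= t by rewrite le_max lexx orbT.
exists t; first by rewrite lt_max ltrDl ltr01.
split; first by apply: le_trans t1; rewrite lerDl powR_ge0.
apply: (@lt_le_trans _ _ (M + 1)).
  by rewrite ltr_pwDr// le_max lexx orbT.
rewrite -[leLHS](@powRVK _ b)//; last by rewrite addr_ge0.
apply: ge0_ler_powR; rewrite ?nnegrE ?powR_ge0 ?(ltW b0)//.
  by apply: le_trans t1; rewrite addr_ge0 ?powR_ge0.
by apply: le_trans t1; rewrite lerDr.
Qed.

Lemma concave_increasing_bij F a b : concave_on `[0, +oo[ F -> F 0 = 0 ->
  (forall x, 0 < x -> 0 < F x) -> 0 < b -> power_growth b a F ->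
  increasing_bij F.
Proof.
move=> cF F0 F_gt0 b0 [C C1 FC].
have C0 : 0 < C by apply: lt_le_trans C1.
have F1 : 0 < F 1 by exact: F_gt0.
have F_unb Y m : exists2 t, m < t & Y < F t.
  have [t mt [t1 Kt]] := powR_unbounded _ (C * Y / F 1) m b0.
  exists t => //; have /andP[+ _] := FC _ _ t1 ltr01.
  rewrite mulr1; apply: lt_le_trans.
  by move: Kt; rewrite ltr_pdivrMr// -mulrA ltr_pdivlMl.
(* Lower growth from [1/t] to 1 gives [F (1/t) <= C * F 1 / t ^ b], which is small for large [t]. *)
have F_small Y : 0 < Y -> exists2 x, 0 < x & F x <= Y.
  move=> Y0; have [t _ [t1 Kt]] := powR_unbounded _ (C * F 1 / Y) 0 b0.
  have t0 : 0 < t by apply: lt_le_trans t1.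
  exists t^-1; first by rewrite invr_gt0.
  have tV0 : 0 < t^-1 by rewrite invr_gt0.
  have /andP[+ _] := FC _ _ t1 tV0; rewrite mulfV ?gt_eqF//.
  move: Kt; rewrite ltr_pdivrMr// => Kt lo.
  have tb0 : 0 < t `^ b by rewrite powR_gt0.
  rewrite -(ler_pM2l tb0); apply/ltW/(le_lt_trans _ Kt).
  by rewrite -ler_pdivrMl// mulrA.
(* If [F y <= F x], unboundedness gives [z > y] with [F z > F y]. As [y] lies between [x] and [z],
   concavity yields [F y > F y]. *)
have F_lt x y : 0 <= x -> x < y -> F x < F y.
  move=> x0 xy; rewrite ltNge; apply/negP => yx.
  have [z yz Fyz] := F_unb (F y) y.
  have xz : 0 < z - x by lra.
  have zx0 : z - x != 0 by rewrite gt_eqF.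
  pose l := (z - y) / (z - x).
  have l01 : 0 <= l <= 1.
    by rewrite divr_ge0 ?ler_pdivrMr//=; lra.
  have l1 : 0 < 1 - l by rewrite subr_gt0 ltr_pdivrMr//; lra.
  have z0 : 0 <= z by lra.
  have := (concave_on_ge0P F).1 cF l x z l01 x0 z0.
  have -> : l * x + (1 - l) * z = y by rewrite /l; field.
  have l0 : 0 <= l by case/andP: l01.
  have := ler_wpM2l l0 yx.
  have : (1 - l) * F y < (1 - l) * F z by rewrite ltr_pM2l.
  have : F y = l * F y + (1 - l) * F y by ring.
  lra.
apply: increasing_bij_intro => // y y0.
(* Instead of continuity, surjectivity uses F (l * x) <= l * F x for l >= 1,
   applied at the supremum of the sublevel set. *)
pose A := [set x | 0 <= x /\ F x <= y].
have [M M0 FM] := F_unb y 0.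
have A_sup : has_sup A.
  split; first by exists 0; split => //; rewrite F0 ltW.
  exists M => x [x0 Fxy]; rewrite leNgt; apply/negP => Mx.
  by have := F_lt _ _ (ltW M0) Mx; rewrite ltNge (le_trans Fxy)// ltW.
have supA0 : 0 < sup A.
  have [x x0 Fx] := F_small _ y0; apply: (lt_le_trans x0).
  by apply: (sup_upper_bound A_sup); split => //; apply: ltW.
exists (sup A); first exact: ltW.
have FA0 := F_gt0 _ supA0.
have [Fy|yF|//] := ltgtP (F (sup A)) y.
  have l1 : 1 < y / F (sup A) by rewrite ltr_pdivlMr ?mul1r.
  have : y / F (sup A) * sup A <= sup A.
    apply: (sup_upper_bound A_sup); split.
      by rewrite mulr_ge0 ?divr_ge0 ?(ltW FA0) ?(ltW y0) ?(ltW supA0).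
    apply: le_trans (concave_scale_le _ _ _ cF _ _ _) _; rewrite ?F0 ?(ltW l1)//.
      exact: ltW.
    by rewrite divfK ?gt_eqF.
  by rewrite ger_pMl// leNgt l1.
(* With [l = F (sup A) / y > 1], the point [sup A / l] lies below some element of [A], so its value
   is less than [y]; scaling back by [l] gives [F (sup A) < F (sup A)]. *)
have l1 : 1 < F (sup A) / y by rewrite ltr_pdivlMr ?mul1r.
have l0 : 0 < F (sup A) / y by rewrite divr_gt0.
have sl : (F (sup A) / y)^-1 * sup A < sup A by rewrite gtr_pMl// invf_lt1.
have sl0 : 0 <= (F (sup A) / y)^-1 * sup A.
  by rewrite mulr_ge0 ?invr_ge0 ?(ltW l0) ?(ltW supA0).
have [x [x0 Fx] slx] := sup_gt A_sup.1 sl.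
have Fsl : F ((F (sup A) / y)^-1 * sup A) < y.
  by apply: lt_le_trans Fx; apply: F_lt.
have := concave_scale_le _ _ _ cF _ (ltW l1) sl0.
rewrite F0 lexx mulVKf ?gt_eqF// => /(_ isT).
rewrite leNgt => /negP[]; rewrite -[ltRHS](divfK (lt0r_neq0 y0)).
by rewrite ltr_pM2l.
Qed.

End concave_functions.

(** * The least concave majorant of a function of power growth *)

Section least_concave_majorant.
Context {R : realType} (Psi : R -> R) (a b C : R).
Hypotheses (b0 : 0 < b) (ba : b <= a) (a1 : a <= 1) (C1 : 1 <= C).
Hypotheses (Psi0 : Psi 0 = 0) (Psi_gt0 : forall t, 0 < t -> 0 < Psi t).
Hypothesis PsiC : forall t u, 1 <= t -> 0 < u ->
  C^-1 * t `^ b * Psi u <= Psi (t * u) <= C * t `^ a * Psi u.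

Let C0 : 0 < C. Proof. exact: lt_le_trans C1. Qed.
Let a0 : 0 < a. Proof. exact: lt_le_trans ba. Qed.

(** The [a]-power controls [Psi] to the right of [s], the [b]-power to the left. Their sum is
    concave, which their maximum in general is not. *)
Definition power_majorant s u := C * Psi s * ((u / s) `^ a + (u / s) `^ b).

Lemma concave_majorant_power s :
  0 < s -> concave_majorant Psi (power_majorant s).
Proof.
move=> s0; have K0 : 0 < C * Psi s by rewrite mulr_gt0// Psi_gt0.
have m_gt0 u : 0 < u -> 0 < power_majorant s u.
  by move=> u0; rewrite mulr_gt0// addr_gt0 ?powR_gt0 ?divr_gt0.
have m0 : power_majorant s 0 = 0.
  by rewrite /power_majorant mul0r !powR0 ?gt_eqF// addr0 mulr0.
split.
- move=> u; rewrite in_itv/= andbT le_eqVlt => /orP[/eqP <-|/m_gt0/ltW//].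
  by rewrite m0.
- apply/concave_on_ge0P => l x y l01 x0 y0; rewrite /power_majorant.
  have sV r : 0 <= r -> 0 <= r / s by move=> ?; rewrite divr_ge0// ltW.
  have -> : (l * x + (1 - l) * y) / s = l * (x / s) + (1 - l) * (y / s) by ring.
  have ca r : 0 < r -> r <= 1 -> l * (x / s) `^ r + (1 - l) * (y / s) `^ r <=
      (l * (x / s) + (1 - l) * (y / s)) `^ r.
    move=> r0 r1; have /concave_on_ge0P cr := concave_powR _ r0 r1.
    by apply: cr => //; exact: sV.
  have := lerD (ca _ a0 a1) (ca _ b0 (le_trans ba a1)).
  rewrite -(ler_pM2l K0); apply: le_trans; rewrite le_eqVlt; apply/orP; left.
  by apply/eqP; ring.
- move=> u; rewrite in_itv/= andbT => u0; split=> [mu|->//].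
  apply/eqP; rewrite eq_le u0 andbT leNgt; apply/negP => /m_gt0.
  by rewrite mu ltxx.
- move=> u; rewrite in_itv/= andbT le_eqVlt => /orP[/eqP <-|u0].
    by rewrite m0 Psi0.
  rewrite /power_majorant.
  have PsiV : 0 <= C * Psi s by exact: ltW.
  have [us|su] := leP u s.
    apply: le_trans (power_growth_le _ _ _ _ _ _ C0 PsiC u0 us) _.
    by rewrite mulrAC ler_wpM2l// lerDr powR_ge0.
  have us1 : 1 <= u / s by rewrite ler_pdivlMr// mul1r ltW.
  have /andP[_] := PsiC _ _ us1 s0; rewrite divfK ?gt_eqF// => up.
  by apply: le_trans up _; rewrite mulrAC ler_wpM2l// lerDl powR_ge0.
Qed.

Notation W := (least_concave_majorant Psi).

Lemma least_concave_majorant_le F t :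
  concave_majorant Psi F -> 0 <= t -> W t <= F t.
Proof.
move=> mF t0; apply: ge_inf; last by exists F.
by exists 0 => _ [G mG <-]; apply: (majorant_ge0 mG); rewrite in_itv/= t0.
Qed.

(** The infimum of an empty set of reals is a default value, so some majorant must be exhibited; the
    one based at 1 serves. *)
Lemma le_least_concave_majorant x t :
  (forall F, concave_majorant Psi F -> x <= F t) -> x <= W t.
Proof.
move=> xF; apply: lb_le_inf; last by move=> _ [F mF <-]; apply: xF.
exists (power_majorant 1 t), (power_majorant 1) => //.
exact: concave_majorant_power.
Qed.

Lemma Psi_le_least t : 0 <= t -> Psi t <= W t.
Proof.
move=> t0; apply: le_least_concave_majorant => F mF.
by apply: (majorant_le mF); rewrite in_itv/= t0.
Qed.

Lemma least_le_Psi t : 0 < t -> W t <= 2 * C * Psi t.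
Proof.
move=> t0; have := least_concave_majorant_le _ _ (concave_majorant_power _ t0).
move=> /(_ _ (ltW t0))/le_trans; apply.
rewrite /power_majorant divff ?gt_eqF// !powR1 le_eqVlt; apply/orP; left.
by apply/eqP; ring.
Qed.

Lemma least_concave_majorant0 : W 0 = 0.
Proof.
apply/eqP; rewrite eq_le; apply/andP; split; last first.
  by have := Psi_le_least _ (lexx 0); rewrite Psi0.
have := least_concave_majorant_le _ 0 (concave_majorant_power 1 ltr01) (lexx _).
by rewrite /power_majorant mul0r !powR0 ?gt_eqF// addr0 mulr0.
Qed.

Lemma least_concave_majorant_gt0 t : 0 < t -> 0 < W t.
Proof.
by move=> t0; apply: lt_le_trans (Psi_le_least _ (ltW t0)); exact: Psi_gt0.
Qed.

(** Each majorant is concave and dominates [W] at both end points; the resulting bound passes to the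
    infimum. *)
Lemma concave_least_concave_majorant : concave_on `[0, +oo[ W.
Proof.
apply/concave_on_ge0P => l x y l01 x0 y0.
apply: le_least_concave_majorant => F mF.
have /concave_on_ge0P cF := majorant_concave mF.
apply: le_trans (cF _ _ _ l01 x0 y0); case/andP: l01 => l0 l1.
by rewrite lerD// ler_wpM2l ?subr_ge0// least_concave_majorant_le.
Qed.

Lemma power_growth_least_concave_majorant : power_growth b a W.
Proof.
have C20 : 0 < 2 * C by rewrite mulr_gt0.
(* One factor [C] comes from the growth of [Psi], the factor [2 * C] from bounding [W] by [Psi]. *)
exists (2 * C * C).
  by rewrite -mulrA -[leLHS]mul1r ler_pM ?ler1n// -[leLHS]mul1r ler_pM.
move=> t u t1 u0; have t0 : 0 < t by apply: lt_le_trans t1.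
have tu0 : 0 < t * u by rewrite mulr_gt0.
have /andP[lo up] := PsiC _ _ t1 u0.
apply/andP; split.
  apply: le_trans (Psi_le_least _ (ltW tu0)); apply: le_trans lo.
  rewrite invfM -![X in X <= _]mulrA mulrCA -[leRHS]mulrA.
  rewrite ler_wpM2l ?invr_ge0 ?(ltW C0)// mulrCA ler_wpM2l ?powR_ge0//.
  by rewrite ler_pdivrMl// least_le_Psi.
apply: le_trans (least_le_Psi _ tu0) _; rewrite -!mulrA.
rewrite ler_wpM2l// ler_wpM2l ?(ltW C0)//.
apply: le_trans up _; rewrite -mulrA ler_wpM2l ?(ltW C0)//.
by rewrite ler_wpM2l ?powR_ge0// Psi_le_least// ltW.
Qed.

Lemma increasing_bij_least_concave_majorant : increasing_bij W.
Proof.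
apply: concave_increasing_bij concave_least_concave_majorant _ _ b0 _.
- exact: least_concave_majorant0.
- exact: least_concave_majorant_gt0.
- exact: power_growth_least_concave_majorant.
Qed.

End least_concave_majorant.

(** * Convex bijections of power growth are N-functions *)

Section convex_bijections.
Context {R : realType}.
Implicit Types (f : R -> R) (p q : R).

Lemma convex_inverse f : increasing_bij f -> concave_on `[0, +oo[ f ->
  convex_function (`[0, +oo[%classic : set R) (inverse_ge0 f).
Proof.
move=> fb /concave_on_ge0P cf; apply/convex_function_ge0P => l x y l01 x0 y0.
have [l0 l1] := andP l01; have l1' : 0 <= 1 - l by rewrite subr_ge0.
have gx := inverse_ge0_ge0 _ _ fb x0; have gy := inverse_ge0_ge0 _ _ fb y0.
have s0 : 0 <= l * x + (1 - l) * y by rewrite addr_ge0// mulr_ge0.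
rewrite -(ibij_leE f) ?inverse_ge0_ge0// ?addr_ge0 ?mulr_ge0//.
apply: le_trans (cf _ _ _ l01 gx gy).
by rewrite !inverse_ge0K.
Qed.

(** Comparison with [f 1] bounds [f t / t] by [C * f 1 * t ^ (p - 1)] from above for [t <= 1], and
    by [f 1 * t ^ (p - 1) / C] from below for [t >= 1]. Both limits follow from [p > 1]. *)
Lemma N_function_power_growth f p q : increasing_bij f ->
  convex_function (`[0, +oo[%classic : set R) f -> 1 < p ->
  power_growth p q f -> N_function f.
Proof.
move=> fb cf p1 [C C1 fC]; have C0 : 0 < C by apply: lt_le_trans C1.
have f1 : 0 < f 1 by exact: ibij_gt0.
have p10 : 0 < p - 1 by rewrite subr_gt0.
have powRBK (t : R) : 0 < t -> t `^ p / t = t `^ (p - 1).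
  move=> t0; rewrite powRB; last by rewrite (gt_eqF t0) implybT.
  by rewrite powRr1// ltW.
split=> //.
- by move=> t; rewrite in_itv/= andbT; exact: ibij_ge0.
- exact: ibij_continuous.
- by move=> x y; rewrite !in_itv/= !andbT => x0 _; exact: ibij_lt.
- move=> t; rewrite in_itv/= andbT => t0; split=> [ft|->]; last exact: ibij0.
  apply/eqP; rewrite eq_le t0 andbT leNgt; apply/negP => /(ibij_gt0 _ _ fb).
  by rewrite ft ltxx.
- have H : C * f 1 * t `^ (p - 1) @[t --> (0:R)^'+] --> (0 : R).
    rewrite -[X in _ --> X](mulr0 (C * f 1)).
    by apply: cvgMl_tmp; exact: powR_cvg0.
  apply: (squeeze_cvgr _ (cvg_cst 0) H); near=> t.
  have t0 : 0 < t by near: t; exact: nbhs_right_gt.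
  have t1 : t <= 1 by near: t; exact: nbhs_right_le.
  rewrite divr_ge0 ?(ltW t0) ?(ibij_ge0 f)// ?(ltW t0)//=.
  rewrite ler_pdivrMr//.
  have := power_growth_le _ _ _ _ _ _ C0 fC t0 t1.
  rewrite divr1 mulrAC -powRBK// => /le_trans; apply.
  by rewrite mulrA divfK ?(gt_eqF t0).
- apply/cvgryPge => A.
  have [t0 _ [t01 At0]] := powR_unbounded _ (C * A / f 1) 0 p10.
  near=> t; have tt0 : t0 <= t by near: t; apply: nbhs_pinfty_ge; exact: num_real.
  have t1 : 1 <= t by apply: le_trans tt0.
  have t_gt0 : 0 < t by apply: lt_le_trans t1.
  have /andP[+ _] := fC _ _ t1 ltr01; rewrite mulr1 => lo.
  rewrite ler_pdivlMr//; apply: le_trans lo.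
  have -> : C^-1 * t `^ p * f 1 = C^-1 * t `^ (p - 1) * f 1 * t.
    by rewrite -powRBK//; field; rewrite !gt_eqF.
  rewrite ler_pM2r// -mulrA ler_pdivlMl// -ler_pdivrMr//.
  apply: le_trans (ltW At0) _.
  by apply: ge0_ler_powR; rewrite ?nnegrE ?(ltW p10) ?(ltW t_gt0)// (le_trans _ t01).
Unshelve. all: by end_near. Qed.

End convex_bijections.

(** * Matuszewska-Orlicz indices and power growth *)

Section indices.
Context {R : realType} (f : R -> R).
Hypothesis f_gt0 : forall u, 0 < u -> 0 < f u.
Hypothesis f_le : forall u v, 0 < u -> u <= v -> f u <= f v.
Implicit Types (c p q t u : R).

Lemma dilation_supP t c : (dilation_sup t f <= c%:E)%E <->
  forall u, 0 < u -> f (t * u) <= c * f u.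
Proof.
split=> [/ereal_supP fc u u0|fc].
  rewrite -ler_pdivrMr ?f_gt0// -lee_fin; apply: fc; exists u => //=.
  by rewrite in_itv/= u0.
apply/ereal_supP => y [u /=]; rewrite in_itv/= andbT => u0 <-.
by rewrite lee_fin ler_pdivrMr ?f_gt0// fc.
Qed.

Lemma dilation_sup_gt0 t : 0 < t -> (0 < dilation_sup t f)%E.
Proof.
move=> t0; apply: (@lt_le_trans _ _ (f (t * 1) / f 1)%:E).
  by rewrite lte_fin divr_gt0// f_gt0// mulr1.
by apply: ereal_sup_ubound; exists 1 => //=; rewrite in_itv/= ltr01.
Qed.

(** A real bound makes the supremum a positive real, hence equal to [t ^ d] for the quotient [d].
    Bounds on the quotient thus become dilation inequalities with constant 1, which can be
    iterated. *)
Lemma dilation_sup_quotient t c : 0 < t -> ln t != 0 ->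
  (forall u, 0 < u -> f (t * u) <= c * f u) ->
  exists d : R, [/\ (lne (dilation_sup t f) / (ln t)%:E)%E = d%:E,
    t `^ d <= c & forall u, 0 < u -> f (t * u) <= t `^ d * f u].
Proof.
move=> t0 lt0 /dilation_supP; have := dilation_sup_gt0 t t0.
case E : dilation_sup => [m| |]//; rewrite lte_fin lee_fin => m0 mc.
exists (ln m / ln t).
have -> : t `^ (ln m / ln t) = m.
  by apply: ln_inj; rewrite ?posrE ?powR_gt0// ln_powR divfK.
split=> //; last by apply/dilation_supP; rewrite E.
by rewrite lne_EFin// inver (negbTE lt0) EFinM.
Qed.

Lemma index_alpha_gt c : (c%:E < index_alpha f)%E -> exists t p,
  [/\ 0 < t < 1, c < p & forall u, 0 < u -> f (t * u) <= t `^ p * f u].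
Proof.
move=> /ereal_sup_gt[y [t /=]]; rewrite in_itv/= => /andP[t0 t1] <- ct.
have lt0 : ln t < 0 by rewrite ln_lt0// t0.
(* Monotonicity bounds the supremum by 1, so the quotient is real. *)
have f1 u : 0 < u -> f (t * u) <= 1 * f u.
  by move=> u0; rewrite mul1r f_le ?mulr_gt0// ler_piMl// ltW.
have [p [pE _ fp]] := dilation_sup_quotient _ _ t0 (ltr0_neq0 lt0) f1.
by exists t, p; rewrite t0 t1; split => //; rewrite -lte_fin -pE.
Qed.

Lemma index_beta_lt (x : \bar R) : (index_beta f < x)%E -> exists t q,
  [/\ 1 < t, 0 <= q, (q%:E < x)%E &
    forall u, 0 < u -> f (t * u) <= t `^ q * f u].
Proof.
move=> /ereal_inf_lt[y [t /=]]; rewrite in_itv/= andbT => t1 <- tx.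
have t0 : 0 < t by apply: lt_trans t1.
have lt0 : 0 < ln t by rewrite ln_gt0.
have lt0' := lt0r_neq0 lt0.
(* An infinite supremum would make the quotient [+oo], which is not below [x]. *)
have [m mE] : exists m : R, (dilation_sup t f <= m%:E)%E.
  move: tx (dilation_sup_gt0 t t0); case: dilation_sup => [m|/=|]//.
    by exists m.
  by rewrite inver (negbTE lt0') gt0_mulye ?lte_fin ?invr_gt0// ltNge leey.
have [q [qE _ fq]] := dilation_sup_quotient _ _ t0 lt0' ((dilation_supP _ _).1 mE).
exists t, q; split => //; last by rewrite -qE.
have ft : f (1 * 1) <= f (t * 1) by apply: f_le; rewrite !mulr1 ?ltW.
have : 1 <= t `^ q.
  rewrite -(ler_pM2r (f_gt0 _ ltr01)); apply: le_trans (fq _ ltr01).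
  by rewrite mul1r -[X in f X <= _]mulr1.
by move=> /ln_ge0; rewrite ln_powR pmulr_lge0.
Qed.

Lemma le_index_alpha t p : 0 < t < 1 ->
  (forall u, 0 < u -> f (t * u) <= t `^ p * f u) -> (p%:E <= index_alpha f)%E.
Proof.
move=> /andP[t0 t1] fp; have lt0 : ln t < 0 by rewrite ln_lt0// t0.
have [d [dE dp _]] := dilation_sup_quotient _ _ t0 (ltr0_neq0 lt0) fp.
apply: (@le_trans _ _ d%:E).
  (* Since [ln t < 0], the bound [t ^ d <= t ^ p] gives [p <= d]. *)
  rewrite lee_fin -(ler_nM2r lt0) -!ln_powR.
  by rewrite ler_ln ?posrE ?powR_gt0.
by apply: ereal_sup_ubound; exists t => //=; rewrite in_itv/= t0.
Qed.

Lemma index_beta_le t q : 1 < t ->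
  (forall u, 0 < u -> f (t * u) <= t `^ q * f u) -> (index_beta f <= q%:E)%E.
Proof.
move=> t1 fq; have t0 : 0 < t by apply: lt_trans t1.
have lt0 : 0 < ln t by rewrite ln_gt0.
have [d [dE dq _]] := dilation_sup_quotient _ _ t0 (lt0r_neq0 lt0) fq.
apply: (@le_trans _ _ d%:E); last first.
  rewrite lee_fin -(ler_pM2r lt0) -!ln_powR.
  by rewrite ler_ln ?posrE ?powR_gt0.
by apply: ereal_inf_lbound; exists t => //=; rewrite in_itv/= t1.
Qed.

(** The inequality at [s < 1], read at [u / s], is a lower bound for dilation by [1 / s > 1]. *)
Lemma dilation_power_growth s t p q : 0 < s < 1 -> 1 < t -> 0 <= p -> 0 <= q ->
  (forall u, 0 < u -> f (s * u) <= s `^ p * f u) ->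
  (forall u, 0 < u -> f (t * u) <= t `^ q * f u) -> power_growth p q f.
Proof.
move=> /andP[s0 s1] t1 p0 q0 fs ft.
have r1 : 1 < s^-1 by rewrite invf_gt1.
apply: (power_growth_dilation _ _ _ _ _ p0 q0 r1 t1) => //.
  by move=> u /f_gt0/ltW.
move=> u u0; have su0 : 0 < s^-1 * u by rewrite mulr_gt0// invr_gt0.
have := fs _ su0; rewrite mulVKf ?gt_eqF// => H.
by rewrite powRV ?(ltW s0)// ler_pdivrMl ?powR_gt0.
Qed.

(** At [u = 1] the two bounds give [t ^ (p - q) <= C * C] for all [t >= 1], impossible if
    [q < p]. *)
Lemma power_growth_exponents p q : power_growth p q f -> p <= q.
Proof.
move=> [C C1 fC]; rewrite leNgt; apply/negP => qp.
have C0 : 0 < C by apply: lt_le_trans C1.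
have pq0 : 0 < p - q by rewrite subr_gt0.
have [t _ [t1]] := powR_unbounded _ (C * C) 0 pq0; apply/negP; rewrite -leNgt.
have t0 : 0 < t by apply: lt_le_trans t1.
have /andP[lo up] := fC _ _ t1 ltr01.
have := le_trans lo up; rewrite ler_pM2r ?f_gt0// ler_pdivrMl// => H.
rewrite powRB; last by rewrite (gt_eqF t0) implybT.
by rewrite ler_pdivrMr ?powR_gt0// -mulrA.
Qed.

(** Otherwise some [q] lies strictly between the indices, and an exponent [p > q] comes from the
    larger one; [f] would have growth [(p, q)] with [q < p]. *)
Lemma index_alpha_le_beta : (index_alpha f <= index_beta f)%E.
Proof.
rewrite leNgt; apply/negP => /index_beta_lt[t [q [t1 q0 qa ft]]].
have [s [p [s01 qp fs]]] := index_alpha_gt _ qa.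
have p0 : 0 <= p by apply: le_trans (ltW qp).
have := power_growth_exponents _ _ (dilation_power_growth _ _ _ _ s01 t1 p0 q0 fs ft).
by rewrite leNgt qp.
Qed.

Lemma power_growth_index_alpha p q :
  power_growth p q f -> 1 < p -> (1 < index_alpha f)%E.
Proof.
move=> [C C1 fC] p1; have C0 : 0 < C by apply: lt_le_trans C1.
(* Half of the excess [p - 1] is spent on absorbing [C] into [t ^ d]; the remaining exponent [p - d]
   still exceeds 1. *)
pose d := (p - 1) / 2; have d0 : 0 < d by rewrite divr_gt0// subr_gt0.
have [t t1 [_ Ct]] := powR_unbounded _ C 1 d0.
have t0 : 0 < t by apply: lt_trans t1.
have tV0 : 0 < t^-1 by rewrite invr_gt0.
apply: (@lt_le_trans _ _ (p - d)%:E); first by rewrite lte_fin /d; lra.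
apply: (@le_index_alpha t^-1) => [|u u0]; first by rewrite tV0 invf_lt1.
have tu0 : 0 < t^-1 * u by rewrite mulr_gt0.
have tu : t^-1 * u <= u by rewrite ler_piMl ?(ltW u0)// invf_le1// ltW.
apply: le_trans (power_growth_le _ _ _ _ _ _ C0 fC tu0 tu) _.
rewrite mulfK ?gt_eqF// ler_pM2r ?f_gt0// powRB; last first.
  by rewrite (gt_eqF tV0) implybT.
by rewrite mulrC ler_pM2l ?powR_gt0// powRV ?(ltW t0)// invrK ltW.
Qed.

Lemma power_growth_index_beta p q :
  power_growth p q f -> (index_beta f < +oo)%E.
Proof.
move=> [C C1 fC]; have [t t1 [_ Ct]] := powR_unbounded _ C 1 ltr01.
have t0 : 0 < t by apply: lt_trans t1.
(* One extra unit of exponent absorbs [C], as [C < t]. *)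
apply: (@le_lt_trans _ _ (q + 1)%:E); last exact: ltry.
apply: (index_beta_le _ _ t1) => u u0.
have /andP[_ up] := fC _ _ (ltW t1) u0; apply: le_trans up _.
rewrite ler_pM2r ?f_gt0// powRD; last by rewrite (gt_eqF t0) implybT.
by rewrite mulrC ler_pM2l ?powR_gt0// ltW.
Qed.

End indices.

(** * Choice of the exponents and assembly *)

Local Open Scope ereal_scope.

(* The first clause of the conclusion says that the inverse function defining
   Phi_theta exists. *)
Theorem theorem3p4 (R : realType) (Phi : R -> R) (theta : R)
    (hPhi : N_function Phi)
    (halpha : 1 < index_alpha Phi)
    (halphabeta : index_alpha Phi <= index_beta Phi)
    (hbeta : index_beta Phi < +oo)
    (htheta0 : (0 < theta)%R)
    (htheta : theta%:E <
      2%:E * mine (index_beta Phi)^-1 (1 - (index_alpha Phi)^-1)) :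
  [/\ set_bij `[0%R, +oo[ `[0%R, +oo[
        (least_concave_majorant (Psi_theta Phi theta)),
      N_function (Phi_theta Phi theta),
      1 < index_alpha (Phi_theta Phi theta),
      index_alpha (Phi_theta Phi theta) <= index_beta (Phi_theta Phi theta) &
      index_beta (Phi_theta Phi theta) < +oo].
Proof.
have Phib := N_function_increasing_bij _ hPhi.
have Phi_gt0 u : (0 < u -> 0 < Phi u)%R by exact: ibij_gt0.
have Phi_le u v : (0 < u -> u <= v -> Phi u <= Phi v)%R.
  by move=> u0; apply: ibij_le => //; exact: ltW.
have [p [q [pq th_p th_q [p0 q0] PhiC]]] : exists p q : R, [/\ (p <= q)%R,
    (theta / 2 < 1 - p^-1)%R, (theta / 2 < q^-1)%R, (0 < p)%R /\ (0 < q)%R &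
    power_growth p q Phi].
  have [a aE] : exists a : R, index_alpha Phi = a%:E.
    have := le_lt_trans halphabeta hbeta.
    by case: (index_alpha Phi) halpha => [a _ _|//|//]; exists a.
  have [b bE] : exists b : R, index_beta Phi = b%:E.
    have := lt_le_trans halpha halphabeta.
    by case: (index_beta Phi) hbeta => [b _ _|//|//]; exists b.
  have a1 : (1 < a)%R by rewrite -lte_fin -aE.
  have ab : (a <= b)%R by rewrite -lee_fin -aE -bE.
  have a0 : (0 < a)%R by rewrite (lt_trans _ a1).
  have b0 : (0 < b)%R by apply: lt_le_trans ab.
  move: htheta; rewrite aE bE !inver !gt_eqF// -EFinB -EFin_min -EFinM lte_fin.
  rewrite -ltr_pdivrMl// mulrC lt_min => /andP[th_b th_a].
  have aV0 : (0 < a^-1)%R by rewrite invr_gt0.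
  have th1 : (0 < 1 - theta / 2)%R by lra.
  have th0 : (0 < theta / 2)%R by rewrite divr_gt0.
  (* The two halves of the condition on [theta] are rewritten as strict bounds on the indices, so
     that single dilations give [p > 1 / (1 - theta/2)] and [q < 2 / theta]. *)
  have : ((1 - theta / 2)^-1)%:E < index_alpha Phi.
    by rewrite aE lte_fin invf_plt ?posrE//; lra.
  move=> /(index_alpha_gt _ Phi_gt0 Phi_le)[s [p [s01 thp Phis]]].
  have : index_beta Phi < ((theta / 2)^-1)%:E.
    by rewrite bE lte_fin -invf_pgt ?posrE.
  move=> /(index_beta_lt _ Phi_gt0 Phi_le)[t [q [t1 q0 qth Phit]]].
  have p0 : (0 < p)%R by apply: lt_trans thp; rewrite invr_gt0.
  have PhiC := dilation_power_growth _ Phi_gt0 Phi_le _ _ _ _ s01 t1 (ltW p0) q0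
    Phis Phit.
  have pq := power_growth_exponents _ Phi_gt0 _ _ PhiC.
  have q_gt0 : (0 < q)%R by apply: lt_le_trans pq.
  exists p, q; split => //.
    by move: thp; rewrite invf_plt ?posrE//; lra.
  by rewrite -invf_pgt ?posrE// -lte_fin.
have pV0 : (0 < p^-1)%R by rewrite invr_gt0.
have qpV : (q^-1 <= p^-1)%R by rewrite lef_pV2 ?posrE.
(* Add [theta/2 < 1 - 1/p] and [theta/2 < 1/q <= 1/p]. *)
have th1 : (theta < 1)%R by lra.
have th1' : (0 < 1 - theta)%R by rewrite subr_gt0.
have gC := power_growth_inverse _ _ _ Phib p0 pq PhiC.
have [C C1 PsiC] := power_growth_Psi_theta _ _ _ _ Phib th1 gC.
set b := ((q^-1 - theta / 2) / (1 - theta))%R in PsiC.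
set a := ((p^-1 - theta / 2) / (1 - theta))%R in PsiC.
have b0 : (0 < b)%R by rewrite divr_gt0// subr_gt0.
have ba : (b <= a)%R by rewrite ler_pM2r ?invr_gt0// lerB.
(* [a < 1] amounts to [theta/2 < 1 - 1/p], just as [b > 0] amounts to [theta/2 < 1/q]. *)
have a1 : (a < 1)%R by rewrite ltr_pdivrMr//; lra.
have a0 : (0 < a)%R by apply: lt_le_trans ba.
have Psi0 : Psi_theta Phi theta 0 = 0%R by rewrite /Psi_theta eqxx.
have Psi_gt0 t : (0 < t -> 0 < Psi_theta Phi theta t)%R.
  exact: Psi_theta_gt0.
pose W := least_concave_majorant (Psi_theta Phi theta).
have Wb : increasing_bij W.
  exact: (increasing_bij_least_concave_majorant _ _ _ _ b0 ba (ltW a1) C1 Psi0).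
have cW : concave_on `[0%R, +oo[ W.
  exact: (concave_least_concave_majorant _ _ _ _ b0 ba (ltW a1) C1 Psi0).
have WC : power_growth b a W.
  exact: (power_growth_least_concave_majorant _ _ _ _ b0 ba (ltW a1) C1 Psi0).
have VC : power_growth a^-1 b^-1 (Phi_theta Phi theta).
  exact: (power_growth_inverse _ _ _ Wb b0 ba WC).
have Vb : increasing_bij (Phi_theta Phi theta).
  exact: increasing_bij_inverse Wb.
have aV1 : (1 < a^-1)%R by rewrite invf_gt1.
have V_gt0 u : (0 < u -> 0 < Phi_theta Phi theta u)%R by exact: ibij_gt0.
have V_le u v : (0 < u -> u <= v -> Phi_theta Phi theta u <= Phi_theta Phi theta v)%R.
  by move=> u0; apply: ibij_le => //; exact: ltW.
split.
- exact: ibij_bij Wb.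
- exact: (N_function_power_growth _ _ _ Vb (convex_inverse _ Wb cW) aV1 VC).
- exact: (power_growth_index_alpha _ V_gt0 _ _ VC aV1).
- exact: index_alpha_le_beta.
- exact: power_growth_index_beta VC.
Qed.
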